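(* Let $X$ be a second countable topological $T_1$-space, and let $\mu$ be the completion of a regular Borel $\sigma$-finite measure on $X$ vanishing on points. Let $\mathcal A$ be the $\sigma$-algebra of $\mu$-measurable sets and $\mathcal J$ the $\sigma$-ideal of $\mu$-zero sets. Then every infinite subset $E$ of $X$ can be decomposed into the union of an infinite family of pairwise disjoint subsets, each of which is a $\mathcal J$-full subset of $E$ (equivalently, each of which is completely non-measurable in $E$). In particular, each of these subsets has the same outer measure $\mu^*$ as $E$.
   Context: Measures are positive and countably additive. $\mu^*$ denotes the outer measure of $\mu$. For $E\subset Q\subset X$, $E$ is a $\mathcal J$-full subset of $Q$ if for each $B\in\mathcal A$ with $E\subset B$ one has $Q\smallsetminus B\in\mathcal J$. A subset $E\subset Q$ is completely non-measurable in $Q$ if for each $A\in\mathcal A$ with $A\cap Q\notin\mathcal J$ one has $A\cap E\notin\mathcal J$ and $A\cap(Q\smallsetminus E)\notin\mathcal J$. *)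

(* Defs.v *)
From HB Require Import structures.
From mathcomp Require Import all_boot all_order all_algebra.
From mathcomp Require Import all_classical all_reals all_analysis.
From mathcomp Require Import measurable_realfun.

Set Implicit Arguments.
Unset Strict Implicit.
Unset Printing Implicit Defensive.
Import Order.TTheory.

Local Open Scope classical_set_scope.
Local Open Scope ring_scope.
Local Open Scope ereal_scope.

Notation borel X := (g_sigma_algebraType (@open X)).

(* Inner regularity is with respect to closed sets because a compact subset of a
   T1 space need not be a Borel set. *)
Definition regular_measure (R : realType) (X : ptopologicalType)
    (nu : set (borel X) -> \bar R) : Prop :=
  forall B : set X, measurable (B : set (borel X)) ->
    nu B = ereal_inf [set nu U | U in [set U : set X | open U /\ B `<=` U]] /\
    nu B = ereal_sup [set nu F | F in [set F : set X | closed F /\ F `<=` B]].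

(* [completed_algebra_gen nu] consists of the sets [B `|` N] with [B] measurable
   and [N] contained in a measurable set of measure zero; it is already a
   sigma-algebra. *)
Notation completed_type nu := (g_sigma_algebraType (completed_algebra_gen nu)).

Definition is_completion (R : realType) (d : measure_display)
    (T : measurableType d) (nu : {measure set T -> \bar R})
    (mu : {measure set (completed_type nu) -> \bar R}) : Prop :=
  forall B N : set T, measurable B -> nu.-negligible N -> mu (B `|` N) = nu B.

Section completion_exists.
Context (R : realType) (d : measure_display) (T : measurableType d).
Context (nu : {measure set T -> \bar R}).
Local Notation U := (completed_type nu).

Lemma negligible_mu_ext (N : set T) : nu.-negligible N -> mu_ext nu N = 0.
Proof.
move=> [A [mA A0 NA]]; apply/eqP; rewrite eq_le outer_measure_ge0 andbT.
by rewrite -A0 -(measurable_mu_extE nu mA); exact: le_outer_measure.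
Qed.

Lemma completed_caratheodory (A : set U) : measurable A ->
  (mu_ext nu).-cara.-measurable (A : set (caratheodory_type (mu_ext nu))).
Proof.
move: A; apply: smallest_sub.
  split; first exact: measurable0.
    by move=> A mA; rewrite setTD; exact: measurableC.
  by move=> F mF; exact: bigcup_measurable.
move=> _ [B mB] [N nN] <-; apply: measurableU.
  by apply: sub_caratheodory; exact: sub_sigma_algebra.
apply: (@measure_is_complete_caratheodory _ _ (mu_ext nu)).
have [A [mA A0 NA]] := nN.
exists A; split; [|apply: negligible_mu_ext|exact: NA]; last first.
  by exists A; split; [exact: mA|exact: A0|exact: subset_refl].
by apply: sub_caratheodory; exact: sub_sigma_algebra.
Qed.

Definition completion_measure : set U -> \bar R := mu_ext nu.
Let completion_measure0 : completion_measure set0 = 0. Proof. exact: outer_measure0. Qed.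
Let completion_measure_ge0 A : 0 <= completion_measure A. Proof. exact: outer_measure_ge0. Qed.
Let completion_measure_sigma_additive : semi_sigma_additive completion_measure.
Proof.
move=> F mF tF mUF.
apply: (@caratheodory_measure_sigma_additive _ _ (mu_ext nu) F) => //.
  by move=> i; exact: completed_caratheodory.
exact: completed_caratheodory.
Qed.
HB.instance Definition _ := isMeasure.Build _ _ _ completion_measure
  completion_measure0 completion_measure_ge0 completion_measure_sigma_additive.

Lemma completion_exists :
  exists mu : {measure set U -> \bar R}, is_completion mu.
Proof.
exists completion_measure => B N mB nN.
rewrite /completion_measure/=; rewrite -(measurable_mu_extE nu mB).
apply/eqP; rewrite eq_le; apply/andP; split; last first.
  by apply: le_outer_measure; exact: subsetUl.
by apply: (le_trans (outer_measureU2 (mu_ext nu) _ _)); rewrite [X in _ + X](negligible_mu_ext nN) adde0.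
Qed.
End completion_exists.

Definition null_sets (R : realType) (d : measure_display)
    (T : measurableType d) (mu : set T -> \bar R) : set (set T) :=
  [set N | measurable N /\ mu N = 0].

Definition full_subset (T : Type) (A J : set (set T)) (Q E : set T) : Prop :=
  E `<=` Q /\ forall B, A B -> E `<=` B -> J (Q `\` B).

Definition completely_nonmeasurable (T : Type) (A J : set (set T))
    (Q E : set T) : Prop :=
  E `<=` Q /\
  forall B, A B -> ~ J (B `&` Q) -> ~ J (B `&` E) /\ ~ J (B `&` (Q `\` E)).

Definition infinite_decomposition (T : Type) (E : set T) (D : set (set T)) :
    Prop :=
  [/\ infinite_set D, trivIset D id & \bigcup_(F in D) F = E].

(* Main.v *)
Require Import Defs.
From HB Require Import structures.
From mathcomp Require Import all_boot all_order all_algebra.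
From mathcomp Require Import all_classical all_reals all_analysis.
From mathcomp Require Import measurable_realfun.

Set Implicit Arguments.
Unset Strict Implicit.
Unset Printing Implicit Defensive.
Import Order.TTheory GRing.Theory Num.Theory.

Local Open Scope classical_set_scope.
Local Open Scope ring_scope.
Local Open Scope ereal_scope.

(** A subset of [E] is full when it has the same measurable hull as [E], and
    [F] is completely non-measurable in [E] exactly when [F] and [E \ F] are
    both full in [E]. So it is enough to split every set [E] into two full
    halves: splitting one of the halves again and again gives infinitely many
    disjoint full subsets of [E]. A null set [E] is decomposed into its points.

    Split pieces of [E] cut out by measurable sets can be glued, so by
    exhaustion it is enough to split some non-null piece of each non-null [E].
    This is a theorem of Lusin. Suppose that no such piece splits. Comparing
    the hulls of [P] and [E \ P] shows that every subset [P] of [E] is the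
    trace on [E] of a measurable set. Let [U] be the union of a maximal chain
    of null subsets of [E], which is not null, and for [x] in [U] let [W x] be
    the set of points that lie in all members of the chain containing [x]. Each
    [W x] is null, so it is covered by an open set of small measure, a union of
    members of a countable base; since the set of [x] using a given member of
    the base is the trace of a measurable set, these covers yield a measurable
    subset of the plane whose vertical section at [x] is null and contains
    [W x]. But for [y] in [U] almost every [x] in [U] has [y] in [W x], so that
    the horizontal sections are not null, contradicting Fubini's theorem. *)

Definition countable_bigcup_closed (T : Type) (G : set (set T)) : Prop :=
  forall F : (set T)^nat, (forall n, G (F n)) -> G (\bigcup_n F n).

Definition sigma_ideal (T : Type) (J : set (set T)) : Prop :=
  [/\ J set0, forall N M, N `<=` M -> J M -> J N & countable_bigcup_closed J].

Section sigma_ideal_theory.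
Context (T : Type) (J : set (set T)).
Hypothesis J_ideal : sigma_ideal J.
Implicit Types E N M : set T.

Lemma sigma_ideal0 : J set0.
Proof. by have [] := J_ideal. Qed.

Lemma sigma_idealS N M : N `<=` M -> J M -> J N.
Proof. by have [_ JS _] := J_ideal; exact: JS. Qed.

Lemma sigma_ideal_bigcup : countable_bigcup_closed J.
Proof. by have [_ _] := J_ideal. Qed.

Lemma sigma_idealU N M : J N -> J M -> J (N `|` M).
Proof.
move=> JN JM; rewrite -bigcup2E; apply: sigma_ideal_bigcup => -[|[|n]] //=.
exact: sigma_ideal0.
Qed.

Lemma sigma_ideal_chain E : (forall x, E x -> J [set x]) -> ~ J E ->
  exists c : set (set T), [/\ total_on c subset,
    forall N, c N -> N `<=` E /\ J N & ~ J (\bigcup_(N in c) N)].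
Proof.
move=> E_points nJE.
pose null_chain (c : set (set T)) :=
  total_on c subset /\ forall N, c N -> N `<=` E /\ J N.
have [C Cchain totC|c [[totc cE] maxc]] := @Zorn_bigcup _ null_chain.
  split=> [N M [c Cc cN] [c' Cc' c'M]|N [c Cc cN]]; last first.
    by have [_] := Cchain _ Cc; exact.
  have [cc'|c'c] := totC _ _ Cc Cc'.
  - by have [tot _] := Cchain _ Cc'; apply: tot => //; exact: cc'.
  - by have [tot _] := Cchain _ Cc; apply: tot => //; exact: c'c.
exists c; split=> // JUc.
have [x Ex nUx] : exists2 x, E x & ~ (\bigcup_(N in c) N) x.
  apply: contrapT => /forall2NP EU; apply: nJE; apply: sigma_idealS JUc => x Ex.
  by have [//|/contrapT] := EU x.
pose M := \bigcup_(N in c) N `|` [set x].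
have cM N : c N -> N `<=` M by move=> cN y Ny; left; exists N.
apply: (maxc (c `|` [set M])).
  split; first exact: subsetUl.
  by move=> /(_ M) cM'; apply: nUx; exists M; [apply: cM'|]; right.
split=> [N1 N2 [cN1|->] [cN2|->]|N [/cE//|->]].
- exact: totc.
- by left; exact: cM.
- by right; exact: cM.
- by left.
- split; last by apply: sigma_idealU => //; exact: E_points.
  by move=> y [[N' /cE[N'E _] /N'E]|->].
Qed.

End sigma_ideal_theory.

Section full_subsets.
Context (T : Type) (A J : set (set T)).
Hypotheses (A_setC : setC_closed A) (A_setU : setU_closed A).
Hypotheses (J_ideal : sigma_ideal J) (J_sub : J `<=` A).
Implicit Types E F B M : set T.

Local Notation full := (full_subset A J).
Local Notation nonmeasurable := (completely_nonmeasurable A J).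

Lemma full_subset_conull E E' : E' `<=` E -> J (E `\` E') -> full E E'.
Proof.
move=> E'E JE; split=> // B _ E'B; apply: (sigma_idealS J_ideal) JE.
exact: setDS.
Qed.

Lemma full_subset_refl E : full E E.
Proof.
by apply: full_subset_conull => //; rewrite setDv; exact: sigma_ideal0.
Qed.

Lemma full_subset_null E F : J E -> F `<=` E -> full E F.
Proof.
move=> JE FE; apply: full_subset_conull => //.
by apply: (sigma_idealS J_ideal) JE; exact: subDsetl.
Qed.

Lemma full_subset_nonempty E F : ~ J E -> full E F -> F !=set0.
Proof.
move=> nJE [_ fF]; apply/set0P/eqP => F0; apply: nJE.
rewrite -(setD0 E); apply: fF; last by rewrite F0.
by apply: J_sub; exact: sigma_ideal0.
Qed.

Lemma full_subsetS E E' F F' : F `<=` F' -> F' `<=` E' -> E' `<=` E ->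
  full E F -> full E' F'.
Proof.
move=> FF' F'E' E'E [_ fF]; split=> // B AB F'B.
apply: (sigma_idealS J_ideal) (fF _ AB _); first exact: setSD.
exact: subset_trans F'B.
Qed.

Lemma full_subset_trans E E' F : full E E' -> full E' F -> full E F.
Proof.
move=> [E'E fE'] [FE' fF]; split=> [|B AB FB]; first exact: subset_trans E'E.
have JE'B := fF _ AB FB.
have JEB : J (E `\` (B `|` (E' `\` B))).
  apply: fE' => [|x E'x]; first exact/A_setU/J_sub.
  by have [Bx|nBx] := pselect (B x); [left|right].
apply: (sigma_idealS J_ideal) (sigma_idealU J_ideal JEB JE'B) => x [Ex nBx].
have [E'x|nE'x] := pselect (E' x); [by right|left].
by split=> // -[|[]].
Qed.

Lemma full_subset_setI E F M : A M -> full E F -> full (E `&` M) (F `&` M).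
Proof.
move=> AM [FE fF]; split=> [|B AB FMB]; first exact: setSI.
have AMB : A (B `|` ~` M) by exact/A_setU/A_setC.
apply: (sigma_idealS J_ideal) (fF _ AMB _) => [x [[Ex Mx] nBx]|x Fx].
  by split=> // -[].
by have [Mx|nMx] := pselect (M x); [left; exact: FMB|right].
Qed.

Lemma full_subset_bigcup (E F : (set T)^nat) :
  (forall n, full (E n) (F n)) -> full (\bigcup_n E n) (\bigcup_n F n).
Proof.
move=> fF; split=> [x [n _ Fx]|B AB UFB].
  by exists n => //; have [FE _] := fF n; exact: FE.
rewrite setDE setI_bigcupl; apply: sigma_ideal_bigcup => // n.
by rewrite -setDE; have [_] := fF n; apply=> // x Fx; apply: UFB; exists n.
Qed.

Lemma full_subsetP E F : F `<=` E ->
  full E F <-> forall B, A B -> ~ J (B `&` E) -> ~ J (B `&` F).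
Proof.
move=> FE; split=> [fF B AB|meetsF]; last first.
  split=> // B AB FB; apply: contrapT; rewrite setDE setIC.
  move=> /(meetsF _ (A_setC AB)); apply; rewrite setIC (disjoints_subset _ _).2.
    exact: sigma_ideal0.
  by rewrite setCK.
apply: contra_not => JBF; have [_ fBF] := full_subset_setI AB fF.
have JEBF : J ((E `&` B) `\` (B `&` F)).
  by apply: fBF; [exact: J_sub|rewrite setIC].
apply: (sigma_idealS J_ideal) (sigma_idealU J_ideal JBF JEBF) => x [Bx Ex].
by have [Fx|nFx] := pselect (F x); [left|right; split=> // -[]].
Qed.

Lemma completely_nonmeasurableP E F :
  nonmeasurable E F <-> full E F /\ full E (E `\` F).
Proof.
split=> [[FE nF]|[fF fEF]].
  by split; apply/full_subsetP => [|B AB /(nF B AB)[]].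
have [[FE _] [EFE _]] := (fF, fEF); split=> // B AB nJ; split.
  exact: (full_subsetP FE).1 nJ.
exact: (full_subsetP EFE).1 nJ.
Qed.

Lemma completely_nonmeasurable_setI E F M : A M ->
  nonmeasurable E F -> nonmeasurable (E `&` M) (F `&` M).
Proof.
move=> AM /completely_nonmeasurableP[fF fEF]; apply/completely_nonmeasurableP.
split; first exact: full_subset_setI.
by rewrite -setIDA setDIr setDv setU0 -setIDAC; exact: full_subset_setI.
Qed.

Lemma completely_nonmeasurable_bigcup (E F : (set T)^nat) : trivIset setT E ->
  (forall n, nonmeasurable (E n) (F n)) ->
  nonmeasurable (\bigcup_n E n) (\bigcup_n F n).
Proof.
move=> tE nF; have {nF}fF n := (completely_nonmeasurableP _ _).1 (nF n).
apply/completely_nonmeasurableP; split.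
  by apply: full_subset_bigcup => n; have [] := fF n.
have fEF : full (\bigcup_n E n) (\bigcup_n (E n `\` F n)).
  by apply: full_subset_bigcup => n; have [] := fF n.
apply: full_subsetS fEF => //.
move=> x [n _ [Ex nFx]]; split; first by exists n.
move=> [m _ Fx]; apply: nFx; have [[FE _] _] := fF m.
by rewrite (_ : n = m)//; apply: tE => //; exists x; split=> //; exact: FE.
Qed.

Lemma completely_nonmeasurable_conull E E' F : E' `<=` E -> J (E `\` E') ->
  nonmeasurable E' F -> nonmeasurable E F.
Proof.
move=> E'E JE /completely_nonmeasurableP[fF fEF].
apply/completely_nonmeasurableP; have fE' := full_subset_conull E'E JE.
split; first exact: full_subset_trans fF.
apply: full_subsetS (full_subset_trans fE' fEF) => //; exact: setSD.
Qed.

Lemma decomposition_full_nonmeasurable E (D : set (set T)) :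
  infinite_decomposition E D ->
  (forall F, D F -> full E F) <-> (forall F, D F -> nonmeasurable E F).
Proof.
move=> [Dinf tD _]; split=> [fD F DF|nD F DF]; last first.
  by have [] := (completely_nonmeasurableP _ _).1 (nD F DF).
apply/completely_nonmeasurableP; split; first exact: fD.
have [G DG GF] : exists2 G, D G & G <> F.
  apply: contrapT => /forall2NP noG; apply: Dinf.
  apply: sub_finite_set (finite_set1 F) => G DG.
  by have [//|/contrapT] := noG G.
apply: full_subsetS (fD _ DG) => //.
move=> x Gx; split; first by have [GE _] := fD _ DG; exact: GE.
by move=> Fx; apply: GF; apply: tD => //; exists x.
Qed.

Lemma disjoint_full_sequence E : (forall Q, exists P, nonmeasurable Q P) ->
  exists2 F : (set T)^nat, forall n, full E (F n) & trivIset setT F.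
Proof.
move=> /choice[P nP]; have {nP}fP Q := (completely_nonmeasurableP _ _).1 (nP Q).
pose Q n := iter n (fun Q => Q `\` P Q) E.
have fQ n : full E (Q n).
  elim: n => [|n fQn]; first exact: full_subset_refl.
  exact: full_subset_trans fQn (fP _).2.
exists (P \o Q) => [n|]; first exact: full_subset_trans (fQ n) (fP _).1.
have Q_decr : {homo Q : m n / (m <= n)%N >-> n `<=` m}.
  apply: homo_leq => [R|R S U SR US|n]; [exact: subset_refl|
    exact: subset_trans SR|exact: subDsetl].
have disj m n : (m < n)%N -> P (Q m) `&` P (Q n) = set0.
  move=> mn; apply/seteqP; split=> // x [Pmx Pnx].
  have [[PQ _] _] := fP (Q n).
  by have [_] := Q_decr _ _ mn _ (PQ _ Pnx).
apply/trivIsetP => m n _ _; rewrite neq_ltn => /orP[/disj//|/disj].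
by rewrite setIC.
Qed.

Lemma full_fibers E : (forall Q, exists P, nonmeasurable Q P) ->
  exists h : T -> nat, forall n, full E (E `&` h @^-1` [set n]).
Proof.
move=> /(disjoint_full_sequence E)[F fF tF].
(* [xget] sends the points lying in no [F n] to [0]. *)
exists (fun x => xget 0%N [set n | F n x]) => n.
have [FE _] := fF n; apply: full_subsetS (fF n) => // x Fx.
split=> /=; first exact: FE.
by apply: xget_subset1 => // i j Fi Fj; apply: tF => //; exists x.
Qed.

End full_subsets.

Lemma fiber_decomposition (T U : Type) (f : T -> U) (E : set T) :
  infinite_set (f @` E) ->
  infinite_decomposition E [set E `&` f @^-1` [set y] | y in f @` E].
Proof.
move=> fEinf; split.
- apply: contra_not fEinf; rewrite (@eq_finite_set _ _ _ (f @` E))//.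
  apply: inj_card_eq => _ y /[1!inE] -[x Ex <-] _ fibers_eq.
  by have [_] : (E `&` f @^-1` [set y]) x by rewrite -fibers_eq.
- by move=> _ _ [y _ <-] [z _ <-] [x [[_ /= <-] [_ /= <-]]].
- apply/seteqP; split=> [x [_ [y _ <-] []//]|x Ex].
  by exists (E `&` f @^-1` [set f x]) => //; exists (f x) => //; exists x.
Qed.

Section exhaustion.
Context (R : realType) (d : measure_display) (T : measurableType d).

Lemma finite_exhaustion (mu : {measure set T -> \bar R}) (G : set (set T)) :
  mu setT < +oo -> G `<=` measurable -> G set0 -> countable_bigcup_closed G ->
  exists2 M, G M & forall B, G B -> mu (B `\` M) = 0.
Proof.
move=> mufin Gm G0 GU.
have /ereal_sup_seq[u Gu u_sup] : [set mu B | B in G] != set0.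
  by apply/set0P; exists (mu set0), set0.
have /choice[F FP] : forall n, exists B, G B /\ mu B = u n.
  by move=> n; have [B ? ?] := Gu n; exists B.
have GF n : G (F n) := (FP n).1.
pose M := \bigcup_n F n; have GM : G M by exact: GU.
exists M => // B GB; have [mM mB] := (Gm _ GM, Gm _ GB).
have GMB : G (M `|` B) by rewrite -bigcup2E; apply: GU => -[|[|n]].
have supM : ereal_sup [set mu B | B in G] <= mu M.
  rewrite -(cvg_lim _ u_sup)//; apply: lime_le; first exact: cvgP u_sup.
  apply: nearW => n; rewrite -(FP n).2 le_measure ?inE//; first exact: Gm.
  exact: bigcup_sup.
have : mu (B `\` M) + mu M <= mu M.
  apply: le_trans supM; apply: ereal_sup_ubound; exists (M `|` B) => //.
  rewrite (measureDI mu (measurableU _ _ mM mB) mM) setUK.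
  by rewrite setDUl setDv set0U.
have Mfin : mu M \is a fin_num.
  by rewrite ge0_fin_numE//; apply: le_lt_trans mufin; rewrite le_measure ?inE.
by rewrite -[leRHS]add0e leeD2rE// measure_le0 => /eqP.
Qed.

Lemma sigma_finite_exhaustion (mu : {sigma_finite_measure set T -> \bar R})
    (G : set (set T)) :
  G `<=` measurable -> G set0 -> countable_bigcup_closed G ->
  exists2 M, G M & forall B, G B -> mu (B `\` M) = 0.
Proof.
move=> Gm G0 GU; have [S ST /all_and2[mS Sfin]] := sigma_finiteT mu.
have /choice[M MP] : forall n, exists M,
    G M /\ forall B, G B -> mu ((B `\` M) `&` S n) = 0.
  move=> n; have restrfin : mrestr mu (mS n) setT < +oo.
    by rewrite /mrestr setTI; exact: Sfin.
  have [M GM maxM] := finite_exhaustion restrfin Gm G0 GU.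
  by exists M; split=> // B; exact: maxM.
have GUM : G (\bigcup_n M n) by apply: GU => n; exact: (MP n).1.
exists (\bigcup_n M n) => // B GB; have [mUM mB] := (Gm _ GUM, Gm _ GB).
apply/negligibleP; first exact: measurableD.
rewrite -(setIT (B `\` _)) ST setI_bigcupr; apply: negligible_bigcup => n.
apply: (@negligibleS _ _ _ mu ((B `\` M n) `&` S n)).
  by apply: setSI; apply: setDS; exact: bigcup_sup.
apply/negligibleP; last exact: (MP n).2.
apply: measurableI => //; apply: measurableD => //.
by apply: Gm; exact: (MP n).1.
Qed.

End exhaustion.

Lemma negligible_sigma_ideal (R : realType) (d : measure_display)
    (T : measurableType d) (mu : {measure set T -> \bar R}) :
  sigma_ideal mu.-negligible.
Proof.
split=> [|N M|F]; first exact: negligible_set0; first exact: negligibleS.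
exact: negligible_bigcup.
Qed.

Section negligible_sections.
Context (R : realType) (d1 d2 : measure_display).
Context (T1 : measurableType d1) (T2 : measurableType d2).
Context (mu1 : {sigma_finite_measure set T1 -> \bar R}).
Context (mu2 : {sigma_finite_measure set T2 -> \bar R}).

Lemma product_measure_eq (K : set (T1 * T2)) : measurable K ->
  (mu1 \x mu2) K = (mu1 \x^ mu2) K.
Proof.
by apply: product_measure_unique => A B mA mB; exact: product_measure2E.
Qed.

Lemma ae_ysection_null (K : set (T1 * T2)) : measurable K ->
  (forall x, mu2 (xsection K x) = 0) ->
  {ae mu2, forall y, mu1 (ysection K y) = 0}.
Proof.
move=> mK K0.
have : \int[mu2]_y `|mu1 (ysection K y)| = 0.
  under eq_integral do rewrite gee0_abs//.
  transitivity ((mu1 \x mu2) K); first by rewrite product_measure_eq.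
  by rewrite /product_measure1; apply: integral0_eq => x _; exact: K0.
have mf := measurable_fun_ysection mu1 mK.
by move=> /(ae_eq_integral_abs mu2 measurableT mf); apply: filterS => y /(_ I).
Qed.

(* [K] is cut down to the vertical lines on which it is null, so that Fubini
   applies although [E1] need not be measurable. *)
Lemma negligible_of_sections (K : set (T1 * T2)) (E1 : set T1) (E2 : set T2) :
  measurable K -> (forall x, E1 x -> mu2 (xsection K x) = 0) ->
  (forall y, E2 y -> mu1.-negligible (E1 `\` ysection K y)) ->
  mu1.-negligible E1 \/ mu2.-negligible E2.
Proof.
move=> mK E1K E2K; have [|nE1] := pselect (mu1.-negligible E1); [by left|right].
pose Z := (mu2 \o xsection K) @^-1` [set 0].
have mZ : measurable Z by rewrite -[Z]setTI; exact: measurable_fun_xsection.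
have mKZ : measurable (K `&` (Z `*` setT)).
  by apply: measurableI => //; exact: measurableX.
have KZ0 x : mu2 (xsection (K `&` (Z `*` setT)) x) = 0.
  rewrite xsectionI; have [Zx|nZx] := pselect (Z x).
    by rewrite in_xsectionX ?inE// setIT.
  by rewrite notin_xsectionX ?notin_setE// setI0.
apply: negligibleS (ae_ysection_null mKZ KZ0) => y E2y /= ysec0; apply: nE1.
have mysec := measurable_ysection y mKZ.
apply: negligibleS (negligibleU (E2K _ E2y) ((negligibleP mu1 mysec).2 ysec0)).
move=> x E1x; have [Kxy|nKxy] := pselect (ysection K y x); [right|by left].
apply/ysectionP; split; first exact/ysectionP.
by split=> //; exact: E1K.
Qed.

End negligible_sections.

Definition discrete_trace (d : measure_display) (T : measurableType d)
    (E : set T) : Prop :=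
  forall P, P `<=` E -> exists2 C, measurable C & P = E `&` C.

Lemma discrete_traceS (d : measure_display) (T : measurableType d)
    (E E' : set T) : E' `<=` E -> discrete_trace E -> discrete_trace E'.
Proof.
move=> E'E dE P PE'; have [C mC PEC] := dE _ (subset_trans PE' E'E).
by exists C => //; rewrite -(setIidl E'E) -setIA -PEC setIidr.
Qed.

Lemma discrete_trace_graph (d1 d2 : measure_display) (T1 : measurableType d1)
    (T2 : measurableType d2) (E : set T1) (V : (set T2)^nat)
    (I : T1 -> set nat) :
  discrete_trace E -> (forall k, measurable (V k)) ->
  exists2 K : set (T1 * T2), measurable K &
    forall x, E x -> xsection K x = \bigcup_(k in I x) V k.
Proof.
move=> dE mV; have /choice[C CP] : forall k, exists C, measurable C /\
    E `&` [set x | I x k] = E `&` C.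
  by move=> k; have [C ? ?] := dE _ (@subIsetl _ E [set x | I x k]); exists C.
exists (\bigcup_k (C k `*` V k)) => [|x Ex].
  by apply: bigcupT_measurable => k; apply: measurableX => //; exact: (CP k).1.
have CI k : C k x <-> I x k.
  have ECI : (E `&` [set x | I x k]) x = (E `&` C k) x by rewrite (CP k).2.
  by split=> [Ck|Ik]; [have [] : (E `&` [set x | I x k]) x by rewrite ECI
                      |have [] : (E `&` C k) x by rewrite -ECI].
apply/seteqP; split=> [y /xsectionP[k _ [/= /CI Ik Vy]]|y [k /CI Ck Vy]].
  by exists k.
by apply/xsectionP; exists k.
Qed.

Definition null_cover_base (R : realType) (d : measure_display)
    (T : measurableType d) (mu : set T -> \bar R) (V : (set T)^nat) : Prop :=
  (forall k, measurable (V k)) /\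
  forall (N : set T) (e : R), mu.-negligible N -> (0 < e)%R ->
    exists I : set nat, N `<=` \bigcup_(k in I) V k /\
      mu (\bigcup_(k in I) V k) <= e%:E.

Lemma discrete_trace_null_enclosure (R : realType) (d1 d2 : measure_display)
    (T1 : measurableType d1) (T2 : measurableType d2)
    (mu : {measure set T2 -> \bar R}) (V : (set T2)^nat) (E : set T1)
    (W : T1 -> set T2) :
  null_cover_base mu V -> discrete_trace E ->
  (forall x, E x -> mu.-negligible (W x)) ->
  exists2 K : set (T1 * T2), measurable K &
    forall x, E x -> W x `<=` xsection K x /\ mu (xsection K x) = 0.
Proof.
move=> [mV covV] dE nW.
have /choice[I IP] : forall xn : T1 * nat, exists I : set nat, E xn.1 ->
    W xn.1 `<=` \bigcup_(k in I) V k /\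
    mu (\bigcup_(k in I) V k) <= (xn.2.+1%:R^-1)%:E.
  move=> [x n]; have [Ex|nEx] := pselect (E x); last by exists set0.
  have n1_gt0 : (0 < n.+1%:R^-1 :> R)%R by rewrite invr_gt0.
  by have [I IP] := covV _ _ (nW _ Ex) n1_gt0; exists I.
have /choice[K KP] : forall n, exists K : set (T1 * T2), measurable K /\
    forall x, E x -> xsection K x = \bigcup_(k in I (x, n)) V k.
  move=> n; have [K ? ?] := discrete_trace_graph (fun x => I (x, n)) dE mV.
  by exists K.
have mK n : measurable (K n) := (KP n).1.
have mcapK : measurable (\bigcap_n K n) by exact: bigcapT_measurable.
exists (\bigcap_n K n) => // x Ex; split=> [y Wy|].
  apply/xsectionP => n _; apply/xsectionP; rewrite (KP n).2//.
  by have [+ _] := IP (x, n) Ex; exact.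
apply/eqP; rewrite -measure_le0; apply/lee_addgt0Pr => e e0; rewrite add0e.
have [n ne] : exists n : nat, (n.+1%:R^-1 < e)%R.
  by have [n] := ltr_add_invr e0; rewrite add0r; exists n.
apply: (@le_trans _ _ (mu (xsection (K n) x))).
  rewrite le_measure ?inE//; [exact: measurable_xsection..|].
  by apply: le_xsection; exact: bigcap_inf.
rewrite (KP n).2//; have [_ /le_trans->//] := IP (x, n) Ex.
by rewrite lee_fin ltW.
Qed.

Lemma discrete_trace_negligible (R : realType) (d : measure_display)
    (T : measurableType d) (mu : {sigma_finite_measure set T -> \bar R})
    (V : (set T)^nat) (E : set T) :
  null_cover_base mu V -> (forall x, E x -> mu.-negligible [set x]) ->
  discrete_trace E -> mu.-negligible E.
Proof.
move=> V_base E_points dE; apply: contrapT => nE.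
have [c [totc cE nUc]] :=
  sigma_ideal_chain (negligible_sigma_ideal mu) E_points nE.
apply: nUc; set U := \bigcup_(N in c) N.
have dU : discrete_trace U.
  by apply: discrete_traceS dE => x [N /cE[NE _] /NE].
pose W x := [set y | forall N, c N -> N x -> N y].
have nW x : U x -> mu.-negligible (W x).
  move=> [N cN Nx]; have [_] := cE _ cN; apply: negligibleS => y; exact.
have [K mK KP] := discrete_trace_null_enclosure V_base dU nW.
suff Unull : mu.-negligible U \/ mu.-negligible U by case: Unull.
apply: (negligible_of_sections mK) => [x /KP[]//|y [N cN Ny]].
have [_] := cE _ cN; apply: negligibleS => x [Ux nKxy].
apply: contrapT => nNx; apply: nKxy; apply/ysectionP/xsectionP.
have [+ _] := KP x Ux; apply=> N' cN' N'x.
by have [NN'|N'N] := totc _ _ cN cN'; [exact: NN'|case: nNx; exact: N'N].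
Qed.

Section complete_measure.
Context (R : realType) (d : measure_display) (T : measurableType d).
Context (mu : {sigma_finite_measure set T -> \bar R}).
Hypothesis mu_complete : measure_is_complete mu.
Implicit Types E P M : set T.

Local Notation full := (full_subset measurable mu.-negligible).
Local Notation nonmeasurable :=
  (completely_nonmeasurable measurable mu.-negligible).

Let null_ideal : sigma_ideal mu.-negligible := negligible_sigma_ideal mu.
Let algebraC : setC_closed (@measurable _ T) := @measurableC _ T.
Let algebraU : setU_closed (@measurable _ T) := @measurableU _ T.

Lemma measurable_hull P : exists2 C, measurable C & full C P.
Proof.
pose G := [set B | measurable B /\ mu.-negligible (B `&` P)].
have [|||M [mM nMP] maxM] := @sigma_finite_exhaustion _ _ _ mu G.
- by move=> B [].
- by split=> //; rewrite set0I; exact: negligible_set0.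
- move=> F GF; split; first by apply: bigcupT_measurable => n; case: (GF n).
  by rewrite setI_bigcupl; apply: negligible_bigcup => n; case: (GF n).
exists (~` (M `\` (M `&` P))).
  by apply: measurableC; apply: measurableD => //; exact: mu_complete.
split=> [x Px [Mx]|B mB PB]; first by apply.
have GB : G (~` B).
  split; first exact: measurableC.
  by rewrite setIC (disjoints_subset _ _).2 ?setCK//; exact: negligible_set0.
apply: (@negligibleS _ _ _ mu (~` B `\` M)) => [x [nMP' nBx]|].
  split=> // Mx; apply: nMP'; split=> // -[_ /PB]; exact: nBx.
apply/negligibleP; last exact: maxM.
by apply: measurableD => //; exact: measurableC.
Qed.

Lemma discrete_trace_or_nonmeasurable E :
  discrete_trace E \/
  exists M P, [/\ measurable M, ~ mu.-negligible (E `&` M) &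
                  nonmeasurable (E `&` M) P].
Proof.
have [|no_part] := pselect (exists M P, [/\ measurable M,
  ~ mu.-negligible (E `&` M) & nonmeasurable (E `&` M) P]); first by right.
left=> P PE; have [C mC fC] := measurable_hull P.
have [C' mC' fC'] := measurable_hull (E `\` P).
have [[PC _] [EPC' _]] := (fC, fC').
pose M := C `&` C'; have mM : measurable M by exact: measurableI.
have nEM : mu.-negligible (E `&` M).
  apply: contrapT => nnEM; apply: no_part; exists M, (P `&` M); split=> //.
  apply/(completely_nonmeasurableP algebraC algebraU null_ideal) => //; split.
    apply: full_subsetS (full_subset_setI _ _ _ mM fC) => //.
      exact: setSI.
    by move=> x [_ [Cx C'x]].
  apply: full_subsetS (full_subset_setI _ _ _ mM fC') => //.
    by move=> x [[Ex nPx] Mx]; split=> // -[].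
  by move=> x [_ [Cx C'x]].
exists (C `\` (E `&` M `\` P)).
  apply: measurableD => //; apply: mu_complete; apply: negligibleS nEM.
  exact: subDsetl.
apply/seteqP; split=> [x Px|x [Ex [Cx nEMP]]].
  by split; [exact: PE|split; [exact: PC|case]].
apply: contrapT => nPx; apply: nEMP; split=> //; split=> //; split=> //.
by apply: EPC'.
Qed.

Section nonmeasurable_subsets.
Context (V : (set T)^nat).
Hypothesis V_base : null_cover_base mu V.
Hypothesis mu_points : forall x, mu.-negligible [set x].

Lemma completely_nonmeasurable_part E : ~ mu.-negligible E ->
  exists M P, [/\ measurable M, ~ mu.-negligible (E `&` M) &
                  nonmeasurable (E `&` M) P].
Proof.
have [dE []|//] := discrete_trace_or_nonmeasurable E.
exact: discrete_trace_negligible V_base _ dE.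
Qed.

Lemma completely_nonmeasurable_exists E : exists P, nonmeasurable E P.
Proof.
pose G := [set M | measurable M /\ exists P, nonmeasurable (E `&` M) P].
have [|||M [mM [P nP]] maxM] := @sigma_finite_exhaustion _ _ _ mu G.
- by move=> M [].
- split=> //; exists set0; rewrite setI0.
  by split=> // B _; rewrite setI0 => /(_ (negligible_set0 mu)).
- move=> F GF; split; first by apply: bigcupT_measurable => n; case: (GF n).
  have /choice[P nP] : forall n, exists P, nonmeasurable (E `&` F n) P.
    by move=> n; case: (GF n).
  pose D := seqDU F; have mD n : measurable (D n).
    apply: measurableD; first by case: (GF n).
    by apply: bigsetU_measurable => i _; case: (GF i).
  exists (\bigcup_n (P n `&` D n)); rewrite seqDU_bigcup_eq setI_bigcupr.
  apply: completely_nonmeasurable_bigcup => // [|n].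
    exact/trivIset_setIl/trivIset_seqDU.
  have DF : D n `<=` F n by exact: subDsetl.
  rewrite -[seqDU F n](setIidr DF) setIA.
  exact: completely_nonmeasurable_setI.
exists P; apply: completely_nonmeasurable_conull nP => //.
rewrite setDIr setDv set0U; apply: contrapT => /completely_nonmeasurable_part.
move=> [M' [P' [mM' + nP']]]; rewrite setIDAC => nEM'; apply: nEM'.
have mM'M : measurable (M' `\` M) by exact: measurableD.
apply: negligibleS (@subIsetr _ _ _) _; apply/negligibleP => //.
rewrite -[M' `\` M](setDidl (setDKI _ _)).
by apply: maxM; split=> //; exists P'; rewrite -setIDAC.
Qed.

Lemma infinite_full_decomposition E : infinite_set E ->
  exists D, infinite_decomposition E D /\ forall F, D F -> full E F.
Proof.
move=> Einf; have [nE|nE] := pselect (mu.-negligible E).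
  exists [set E `&` id @^-1` [set y] | y in id @` E]; split.
    by apply: fiber_decomposition; rewrite image_id.
  by move=> _ [y _ <-]; apply: full_subset_null.
have [h fh] := full_fibers algebraC algebraU null_ideal mu_complete E
  completely_nonmeasurable_exists.
exists [set E `&` h @^-1` [set n] | n in h @` E]; split; last first.
  by move=> _ [n _ <-].
apply: fiber_decomposition; apply: (sub_infinite_set _ infinite_nat) => n _.
have [x [Ex <-]] := full_subset_nonempty null_ideal mu_complete nE (fh n).
by exists x.
Qed.

End nonmeasurable_subsets.
End complete_measure.

Section sigma_finite_copy.
Context (R : realType) (d : measure_display) (T : measurableType d).
Context (mu : {measure set T -> \bar R}) (mu_sf : sigma_finite [set: T] mu).

(* Sigma-finiteness is a mere hypothesis on a [{measure set T -> \bar R}]; the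
   copy carries it as a structure. *)
Definition sigma_finite_copy of sigma_finite [set: T] mu : set T -> \bar R :=
  mu.
Local Notation copy := (sigma_finite_copy mu_sf).

HB.instance Definition _ := Measure.on copy.
HB.instance Definition _ := Measure_isSigmaFinite.Build _ _ _ copy mu_sf.

End sigma_finite_copy.

Lemma mu_ext_full_subset (R : realType) (d : measure_display)
    (T : measurableType d) (mu : {measure set T -> \bar R}) (E F : set T) :
  full_subset measurable mu.-negligible E F -> mu^*%mu F = mu^*%mu E.
Proof.
move=> [FE fF]; apply/eqP; rewrite eq_le le_outer_measure//=.
apply: le_ereal_inf_tmp => _ [A [mA FA] <-].
have nEA := fF _ (bigcupT_measurable _ mA) FA.
have EA : E `<=` \bigcup_n A n `|` (E `\` \bigcup_n A n).
  by move=> x Ex; have [?|?] := pselect ((\bigcup_n A n) x); [left|right].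
apply: le_trans (le_outer_measure (mu_ext mu) _ _ EA) _.
apply: le_trans (outer_measureU2 (mu_ext mu) _ _) _.
rewrite [X in _ + X](negligible_mu_ext nEA) adde0.
apply: le_trans (outer_measure_sigma_subadditive (mu_ext mu) A) _.
by rewrite (@eq_eseriesr _ _ (mu \o A)) => // n _; exact: measurable_mu_extE.
Qed.

Lemma null_sets_complete (R : realType) (d : measure_display)
    (T : measurableType d) (mu : {measure set T -> \bar R}) :
  measure_is_complete mu -> null_sets mu = mu.-negligible.
Proof.
move=> mu_complete; apply/seteqP; split=> [N [mN N0]|N nN].
  exact/(negligibleP mu mN).
have mN : measurable N by exact: mu_complete.
by split=> //; exact: measure_negligible.
Qed.

Lemma measurable_completedE (R : realType) (d : measure_display)
    (T : measurableType d) (nu : {measure set T -> \bar R}) :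
  @measurable _ (completed_type nu) = completed_algebra_gen nu.
Proof.
apply/seteqP; split; last exact: sub_sigma_algebra.
apply: smallest_sub => //; split.
- by exists set0 => //; exists set0; [exact: negligible_set0|rewrite setU0].
- move=> _ [B mB [N [Z [mZ Z0 NZ]] <-]].
  exists (~` B `\` Z); first by apply: measurableD => //; exact: measurableC.
  exists (~` B `&` (Z `\` N)); first by exists Z; split=> // x [_ []].
  rewrite setTD setCU; apply/seteqP; split=> x.
    by move=> [[nBx nZx]|[nBx [_ nNx]]]; split=> // /NZ.
  by move=> [nBx nNx]; have [Zx|nZx] := pselect (Z x); [right|left].
- move=> F genF; have /choice[BN /all_and3[mB nN BNF]] : forall n,
      exists BN : set T * set T,
        [/\ measurable BN.1, nu.-negligible BN.2 & BN.1 `|` BN.2 = F n].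
    by move=> n; have [B mB [N nN BNF]] := genF n; exists (B, N).
  exists (\bigcup_n (BN n).1); first exact: bigcupT_measurable.
  exists (\bigcup_n (BN n).2); first exact: negligible_bigcup.
  by rewrite -bigcupU; apply: eq_bigcupr => n _; exact: BNF.
Qed.

Section completion.
Context (R : realType) (d : measure_display) (T : measurableType d).
Context (nu : {measure set T -> \bar R}).
Context (mu : {measure set (completed_type nu) -> \bar R}).
Hypothesis mu_completion : is_completion mu.

Lemma measurable_completed (B : set T) :
  measurable B -> measurable (B : set (completed_type nu)).
Proof.
move=> mB; apply: sub_sigma_algebra; exists B => //.
by exists set0; [exact: negligible_set0|rewrite setU0].
Qed.

Lemma completion_measurableE (B : set T) : measurable B -> mu B = nu B.
Proof.
by move=> mB; rewrite -(mu_completion mB (negligible_set0 nu)) setU0.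
Qed.

Lemma completion_negligibleE : mu.-negligible = nu.-negligible.
Proof.
apply/seteqP; split=> N; last first.
  move=> [Z [mZ Z0 NZ]]; exists Z; split=> //.
    exact: measurable_completed.
  by rewrite completion_measurableE.
move=> [Z []]; rewrite measurable_completedE.
move=> [B mB [M nM <-]]; rewrite mu_completion// => B0 NZ.
have nB : nu.-negligible B by exact/(negligibleP nu mB).
exact: (@negligibleS _ T _ nu (B `|` M) N NZ (negligibleU nB nM)).
Qed.

Lemma completion_complete : measure_is_complete mu.
Proof.
move=> N; rewrite completion_negligibleE => nN.
by apply: sub_sigma_algebra; exists set0 => //; exists N => //; rewrite set0U.
Qed.

Lemma completion_sigma_finite :
  sigma_finite [set: T] nu -> sigma_finite [set: completed_type nu] mu.
Proof.
move=> [F FT Ffin]; exists F => // n; have [mF Foo] := Ffin n.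
by split; [exact: measurable_completed|rewrite completion_measurableE].
Qed.

Lemma completion_null_cover_base (V : (set T)^nat) :
  null_cover_base nu V -> null_cover_base mu V.
Proof.
move=> [mV covV]; split=> [k|N e]; first exact: measurable_completed.
rewrite completion_negligibleE => nN e0; have [I [NV Ve]] := covV N e nN e0.
exists I; split=> //; rewrite completion_measurableE//.
exact: bigcup_measurable.
Qed.

End completion.

Lemma second_countable_open_seq (X : topologicalType) : @second_countable X ->
  exists V : (set X)^nat, (forall k, open (V k)) /\
    forall U : set X, open U -> U = \bigcup_(k in [set k | V k `<=` U]) V k.
Proof.
move=> [B cB [oB Bnbhs]].
have /pcard_surjP[g Bg] := cB.
have gV k : B (g k) -> (g k)° = g k by move=> /oB /interior_id.
exists (fun k => (g k)°); split=> [k|U oU]; first exact: open_interior.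
apply/seteqP; split=> [x Ux|x [k VkU /VkU//]].
have [W [BW Wx] WU] : filter_from [set W | B W /\ W x] id U.
  by apply: Bnbhs; exact: open_nbhs_nbhs.
by have [k _ gW] := Bg _ BW; exists k; rewrite /= gV gW.
Qed.

Lemma open_borel (X : ptopologicalType) (U : set X) :
  open U -> measurable (U : set (borel X)).
Proof. exact: sub_sigma_algebra. Qed.

Lemma borel_set1 (X : ptopologicalType) (x : X) :
  accessible_space X -> measurable ([set x] : set (borel X)).
Proof.
move=> X_T1; rewrite -[[set x]]setCK; apply: measurableC; apply: open_borel.
by rewrite openC; exact: accessible_closed_set1.
Qed.

Lemma regular_null_cover_base (R : realType) (X : ptopologicalType)
    (nu : {measure set (borel X) -> \bar R}) :
  @second_countable X -> regular_measure nu ->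
  exists V : (set (borel X))^nat, null_cover_base nu V.
Proof.
move=> /second_countable_open_seq[V [oV VU]] nu_regular; exists V.
split=> [k|N e [Z [mZ Z0 NZ]] e0]; first exact: open_borel.
have [Zinf _] := nu_regular _ mZ.
have /ereal_inf_lt[_ [U [oU ZU] <-] Ue] :
    ereal_inf [set nu U | U in [set U : set X | open U /\ Z `<=` U]] < e%:E.
  by rewrite -Zinf Z0 lte_fin.
exists [set k | V k `<=` U]; rewrite -(VU _ oU); split; last exact: ltW.
exact: subset_trans ZU.
Qed.

Theorem corollary3p1 (R : realType) (X : ptopologicalType)
    (nu : {measure set (borel X) -> \bar R})
    (mu : {measure set (completed_type nu) -> \bar R})
    (X_second_countable : @second_countable X)
    (X_T1 : accessible_space X)
    (nu_regular : regular_measure nu)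
    (nu_sigma_finite : sigma_finite [set: borel X] nu)
    (nu_points : forall x : X, nu [set x] = 0)
    (mu_completion : is_completion mu)
    (E : set X) (E_infinite : infinite_set E) :
  let A : set (set X) := @measurable _ (completed_type nu) in
  let J : set (set X) := null_sets mu in
  (exists D : set (set X),
     infinite_decomposition E D /\
     forall F : set X, D F ->
       [/\ full_subset A J E F,
           completely_nonmeasurable A J E F
         & mu^*%mu F = mu^*%mu E]) /\
  (forall D : set (set X), infinite_decomposition E D ->
     (forall F : set X, D F -> full_subset A J E F) <->
     (forall F : set X, D F -> completely_nonmeasurable A J E F)).
Proof.
move=> A; have mu_complete := completion_complete mu_completion.
rewrite (null_sets_complete mu_complete) => J.
have full_nonmeasurable (D : set (set X)) :=
  @decomposition_full_nonmeasurable _ A J (@measurableC _ (completed_type nu))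
    (@measurableU _ (completed_type nu)) (negligible_sigma_ideal mu)
    mu_complete E D.
split; last exact: full_nonmeasurable.
have mu_points (x : X) : mu.-negligible [set x].
  rewrite (completion_negligibleE mu_completion).
  exact/(negligibleP nu (borel_set1 x X_T1))/nu_points.
have [V V_base] := regular_null_cover_base X_second_countable nu_regular.
have mu_sf := completion_sigma_finite mu_completion nu_sigma_finite.
have [D [DE fD]] :=
  @infinite_full_decomposition _ _ _ (sigma_finite_copy mu_sf) mu_complete V
    (completion_null_cover_base mu_completion V_base) mu_points E E_infinite.
exists D; split=> // F DF; split; first exact: fD.
- exact: (full_nonmeasurable D DE).1.
- exact/mu_ext_full_subset/fD.
Qed.
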